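(* Let $h>0$, $a\in\mathbb{R}$, $\nu\in(0,1]$, and let $x,y:(h\mathbb{N})_a\to\mathbb{R}$ satisfy $({}_a\Delta_{h}^{\nu}x)(t)\ge({}_a\Delta_{h}^{\nu}y)(t)$ for all $t\in(h\mathbb{N})_{a+(1-\nu)h}$, and $x(a)\le y(a)$. Then $x(t)-y(t)\ge x(a)-y(a)$ for all $t\in(h\mathbb{N})_a$.
   Context: For $h>0$ and $a\in\mathbb{R}$, $(h\mathbb{N})_a=\{a,a+h,a+2h,\dots\}$, $\sigma(t)=t+h$, and $(\Delta_h y)(t)=\frac{y(t+h)-y(t)}{h}$. The $h$-factorial function is $t_h^{(\alpha)}=h^{\alpha}\frac{\Gamma(t/h+1)}{\Gamma(t/h+1-\alpha)}$, taken to be $0$ when $t/h+1-\alpha$ is a nonpositive integer and $t/h+1$ is not. For $\mu>0$ the fractional $h$-sum is $({}_a\Delta_h^{-\mu}y)(t)=\frac{h}{\Gamma(\mu)}\sum_{s=a/h}^{t/h-\mu}(t-\sigma(sh))_h^{(\mu-1)}y(sh)$ for $t\in(h\mathbb{N})_{a+\mu h}$, where $s$ runs over $a/h,a/h+1,\dots,t/h-\mu$ and $\sigma(sh)=(s+1)h$; and ${}_a\Delta_h^{0}y=y$. For $\nu\in(0,1]$ the Riemann–Liouville-like fractional $h$-difference is $({}_a\Delta_{h}^{\nu}y)(t)=(\Delta_h({}_a\Delta_h^{-(1-\nu)}y))(t)$, $t\in(h\mathbb{N})_{a+(1-\nu)h}$ (so it equals $\Delta_h y$ if $\nu=1$). 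*)

(* Defs.v *)
From HB Require Import structures.
From mathcomp Require Import all_boot all_order all_algebra.
From mathcomp Require Import all_classical all_reals all_analysis.

Set Implicit Arguments.
Unset Strict Implicit.
Unset Printing Implicit Defensive.

Import Order.TTheory GRing.Theory Num.Theory.
Import numFieldNormedType.Exports.

Local Open Scope classical_set_scope.
Local Open Scope ring_scope.

Definition nonpos_int (R : realType) (u : R) : bool :=
  (u \is a Num.int) && (u <= 0).

Definition Euler_integral (R : realType) (u : R) : R :=
  (\int[lebesgue_measure]_(s in `]0, +oo[) (s `^ (u - 1) * expR (- s)))%R.

(* Euler's integral for u > 0, continued to u <= 0 by n iterations of
   Gamma(u) = Gamma(u + 1) / u, where n is large enough for u + n > 0.
   At the poles 0, -1, -2, ... the product vanishes and the value is 0. *)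
Definition Gamma (R : realType) (u : R) : R :=
  if 0 < u then Euler_integral u
  else let n := (Num.truncn (- u)).+1 in
       Euler_integral (u + n%:R) / \prod_(i < n) (u + i%:R).

(* The grid (hN)_a; (hN)_a with h = 1 is {a, a + 1, a + 2, ...}. *)
Definition hgrid (R : realType) (h a : R) : set R :=
  [set t | exists k : nat, t = a + k%:R * h].

(* Functions on a grid are given by total functions R -> R; only their values
   at grid points are used below. *)
Definition hdiff (R : realType) (h : R) (y : R -> R) (t : R) : R :=
  (y (t + h) - y t) / h.

(* No convention is attached to the case where t / h + 1 is a pole of Gamma. *)
Definition hfactorial (R : realType) (h t alpha : R) : R :=
  if nonpos_int (t / h + 1 - alpha) && ~~ nonpos_int (t / h + 1) then 0
  else h `^ alpha * (Gamma (t / h + 1) / Gamma (t / h + 1 - alpha)).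

Definition hsigma (R : realType) (h t : R) : R := t + h.

(* The summation variable s is real: s = a / h, a / h + 1, ..., t / h - mu. *)
Definition hsum (R : realType) (h a mu : R) (y : R -> R) (t : R) : R :=
  if mu == 0 then y t
  else h / Gamma mu *
       \sum_(s \in hgrid 1 (a / h) `&` [set s | s <= t / h - mu])
          (hfactorial h (t - hsigma h (s * h)) (mu - 1) * y (s * h)).

Definition RL_hdiff (R : realType) (h a nu : R) (y : R -> R) : R -> R :=
  hdiff h (hsum h a (1 - nu) y).

(* Main.v *)
Require Import Defs.
From HB Require Import structures.
From mathcomp Require Import all_boot all_order all_algebra.
From mathcomp Require Import all_classical all_reals all_analysis.
From mathcomp Require Import measurable_realfun.
From mathcomp Require Import ring lra.

(** With z := x - y, everything is linear and the claim is z(t) >= z(a) when the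
    fractional difference of z is nonnegative and z(a) <= 0.

    If nu = 1 the hypothesis says that z is nondecreasing along the grid.

    If nu < 1, put mu = 1 - nu in (0, 1).  On the k-th point of its grid the
    fractional sum of z is a positive constant times the convolution

      S_k = sum_(j <= k) w_(k - j) z_j,    w_m = Gamma (mu + m) / Gamma (m + 1),

    where z_j = z(a + j h) [hsum_grid], so the hypothesis is S_k <= S_(k+1).
    The recurrence Gamma (u + 1) = u Gamma u gives
    w_(m+1) = w_m (mu + m) / (m + 1), so the weights are positive and, since
    mu <= 1, nonincreasing.  Solving S_k <= S_(k+1) for the last term,

      w_0 z_(k+1) >= sum_(j <= k) (w_(k-j) - w_(k-j+1)) z_j,

    where the coefficients on the right are nonnegative and telescope to
    w_0 - w_(k+1) <= w_0.  If z_j >= z_0 for all j <= k, the right-hand side is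
    at least (w_0 - w_(k+1)) z_0, hence at least w_0 z_0 because z_0 <= 0: this
    is a strong induction [convolution_le], and the place where x(a) <= y(a) is
    used.

    The two facts on Gamma, positivity and the recurrence, come from Euler's
    integral taken in the extended reals, where it is defined with no
    integrability condition: the recurrence is integration by parts on
    [1/(n+2), n+2] followed by monotone convergence [ext_Euler_integralD1], and
    finiteness is then deduced from the value at 1 [ext_Euler_integral_lty]. *)

Import Order.TTheory GRing.Theory Num.Theory.
Import numFieldNormedType.Exports.

Local Open Scope classical_set_scope.
Local Open Scope ring_scope.

(** * Euler's integral *)

Definition Euler_kernel {R : realType} (u s : R) : R :=
  s `^ (u - 1) * expR (- s).

(** Extended-real version of Euler's integral: a possible divergence is visible
    as +oo, whereas the real-valued integral would then be 0. *)
Definition ext_Euler_integral {R : realType} (u : R) : \bar R :=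
  (\int[lebesgue_measure]_(s in `]0%R, +oo[) (Euler_kernel u s)%:E)%E.

Lemma Euler_kernel_ge0 {R : realType} (u s : R) : 0 <= Euler_kernel u s.
Proof. by rewrite mulr_ge0 ?powR_ge0 ?expR_ge0. Qed.

Lemma continuous_powR {R : realType} (p s : R) :
  0 < s -> {for s, continuous (fun t : R => t `^ p)}.
Proof.
move=> s0; apply/differentiable_continuous/derivable1_diffP.
by apply: derivable_powR; rewrite in_itv/= andbT.
Qed.

Lemma continuous_expRN {R : realType} (s : R) :
  {for s, continuous (fun s : R => expR (- s))}.
Proof.
apply: (@continuous_comp _ _ _ (-%R) (@expR R)).
  exact: opp_continuous.
exact: continuous_expR.
Qed.

Lemma continuous_Euler_kernel {R : realType} (u s : R) :
  0 < s -> {for s, continuous (Euler_kernel u)}.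
Proof.
move=> s0; apply: continuousM; first exact: continuous_powR.
exact: continuous_expRN.
Qed.

Lemma measurable_Euler_kernel {R : realType} (u : R) :
  measurable_fun (`]0, +oo[%classic : set R) (Euler_kernel u).
Proof.
apply: open_continuous_measurable_fun; first exact: interval_open.
move=> s; rewrite inE/= in_itv/= andbT => s0.
exact: continuous_Euler_kernel.
Qed.

(** The integrand may be singular at 0 and the range is unbounded, so
    integration by parts is only available on compact segments of ]0, +oo[.
    These exhaust it; they start from n + 2 to be nondegenerate. *)
Lemma cvg_ext_Euler_integral {R : realType} (u : R) :
  (\int[lebesgue_measure]_(s in `[n.+2%:R^-1%R, n.+2%:R%R])
     (Euler_kernel u s)%:E @[n --> \oo] --> ext_Euler_integral u)%E.
Proof.
rewrite /ext_Euler_integral.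
have -> : `]0, +oo[%classic = \bigcup_n `[n.+2%:R^-1 : R, n.+2%:R]%classic.
  apply/seteqP; split=> s /=.
    rewrite in_itv/= andbT => s0.
    pose m := maxn (Num.truncn s) (Num.truncn s^-1).
    have ltm (v : R) : (Num.truncn v <= m)%N -> v <= m.+2%:R.
      move=> vm; apply: le_trans (ltW (truncnS_gt v)) _.
      by rewrite ler_nat ltnS (leq_trans vm).
    exists m => //=; rewrite in_itv/= ltm ?leq_maxl// andbT.
    by rewrite invf_ple ?posrE// ltm// leq_maxr.
  case=> n _ /=; rewrite !in_itv/= andbT => /andP[+ _].
  by apply: lt_le_trans.
apply: ge0_nondecreasing_set_cvg_integral => //.
- apply/nondecreasing_seqP => n; apply/subsetPset => s/=; rewrite !in_itv/=.
  move=> /andP[ns sn]; apply/andP; split.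
    by apply: le_trans ns; rewrite lef_pV2 ?posrE// ler_nat.
  by apply: le_trans sn _; rewrite ler_nat.
- move=> n; apply/measurable_EFinP.
  apply: measurable_funS (measurable_Euler_kernel u) => // s/=.
  by rewrite !in_itv/= andbT => /andP[+ _]; apply: lt_le_trans.
- by move=> n s _; rewrite lee_fin Euler_kernel_ge0.
Qed.

Lemma segment_continuous {R : realType} (f : R -> R) (a b : R) :
  (forall x, a <= x -> {for x, continuous f}) -> {within `[a, b], continuous f}.
Proof.
move=> cf; apply: continuous_in_subspaceT => x; rewrite inE/= in_itv/=.
by move=> /andP[ax _]; exact: cf.
Qed.

Lemma segment_derivable {R : realType} (f : R -> R) (a b : R) : a < b ->
  (forall x, a <= x -> derivable f x 1) -> derivable_oo_LRcontinuous f a b.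
Proof.
move=> ab df.
have cf x : a <= x -> {for x, continuous f}.
  by move=> ax; apply/differentiable_continuous/derivable1_diffP/df.
split.
- by move=> x; rewrite in_itv/= => /andP[ax _]; exact/df/ltW.
- by apply: cvg_at_right_filter; exact: cf.
- by apply: cvg_at_left_filter; exact/cf/ltW.
Qed.

Lemma Euler_integral_by_parts {R : realType} (u a b : R) :
  0 < u -> 0 < a -> a < b ->
  (\int[lebesgue_measure]_(s in `[a, b]) (Euler_kernel (u + 1) s)%:E =
   (Euler_kernel (u + 1) a - Euler_kernel (u + 1) b)%:E +
   u%:E * \int[lebesgue_measure]_(s in `[a, b]) (Euler_kernel u s)%:E)%E.
Proof.
move=> u0 a0 ab; rewrite /Euler_kernel addrK.
have gt0 x : a <= x -> 0 < x by exact: lt_le_trans.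
have dN (x : R) : is_derive x 1 (fun s : R => - expR (- s)) (expR (- x)).
  by apply: is_derive_eq; rewrite mulrN1 opprK.
have cP p : {within `[a, b], continuous (fun t : R => t `^ p)}.
  by apply: segment_continuous => x ax; exact/continuous_powR/gt0.
rewrite (@integration_by_parts R (fun t => t `^ u) (fun s => - expR (- s))
   (fun s => u * s `^ (u - 1)) (fun s => expR (- s)))//; last 6 first.
- apply: segment_continuous => x ax; apply: continuousM.
    exact: cst_continuous.
  exact/continuous_powR/gt0.
- apply: segment_derivable => // x /gt0 x0.
  by apply: derivable_powR; rewrite in_itv/= andbT.
- move=> x; rewrite in_itv/= => /andP[/ltW/gt0 x0 _].
  by rewrite powR_derive1// in_itv/= andbT.
- by apply: segment_continuous => x _; exact: continuous_expRN.
- by apply: segment_derivable => // x _; apply: ex_derive.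
- by move=> x _; rewrite derive1E; apply: derive_val.
have -> : (\int[lebesgue_measure]_(s in `[a, b])
             (u * s `^ (u - 1) * - expR (- s))%:E =
           - (u%:E * \int[lebesgue_measure]_(s in `[a, b])
                (Euler_kernel u s)%:E))%E.
  rewrite -ge0_integralZl//; last 3 first.
  - apply/measurable_EFinP.
    apply: measurable_funS (measurable_Euler_kernel u) => // s/=.
    by rewrite !in_itv/= andbT => /andP[/gt0].
  - by move=> s _; rewrite lee_fin Euler_kernel_ge0.
  - by rewrite lee_fin ltW.
  rewrite -integral_ge0N; last first.
    by move=> s _; rewrite mule_ge0// lee_fin ?Euler_kernel_ge0// ltW.
  by apply: eq_integral => s _; rewrite /Euler_kernel -EFinM -EFinN; congr EFin;
    ring.
by rewrite oppeK; congr (_%:E + _)%E; ring.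
Qed.

(** From v <= exp v at v = s / (2 u): raised to the power u it bounds the
    growth of s^u by that of exp (s / 2), and half of the exponential decay
    is left. *)
Lemma powR_expRN_le {R : realType} (u s : R) : 0 < u -> 0 < s ->
  s `^ u * expR (- s) <= (2 * u) `^ u * expR (- (s / 2)).
Proof.
move=> u0 s0; have u20 : 0 < 2 * u by rewrite mulr_gt0.
have -> : s `^ u = (2 * u) `^ u * (s / (2 * u)) `^ u.
  rewrite -powRM; [|lra|by rewrite divr_ge0// ltW].
  by congr powR; field; lra.
rewrite -mulrA ler_wpM2l ?powR_ge0//.
have -> : expR (- (s / 2)) = expR (s / 2) * expR (- s).
  by rewrite -expRD; congr expR; lra.
rewrite ler_wpM2r ?expR_ge0//.
have -> : s / 2 = u * (s / (2 * u)) by field; lra.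
rewrite [u * _]mulrC expRM ge0_ler_powR ?nnegrE ?expR_ge0//; first exact: ltW.
  by rewrite divr_ge0// ltW.
by apply: le_trans (expR_ge1Dx _); rewrite lerDr.
Qed.

Lemma Euler_boundary_cvg {R : realType} (u : R) : 0 < u ->
  Euler_kernel (u + 1) n.+2%:R^-1 - Euler_kernel (u + 1) n.+2%:R
    @[n --> \oo] --> 0.
Proof.
move=> u0; rewrite -[X in _ --> X]subr0.
have harm2 : n.+2%:R^-1 @[n --> \oo] --> (0 : R).
  by have := @cvg_harmonic R; rewrite -cvg_shiftS.
rewrite /Euler_kernel addrK; apply: cvgB.
  apply: (@squeeze_cvgr _ _ _ _ (cst 0) (fun n => n.+2%:R^-1 `^ u)).
  - near=> n; rewrite mulr_ge0 ?powR_ge0 ?expR_ge0//=.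
    by rewrite ler_piMr ?powR_ge0// -expR0 ler_expR oppr_le0.
  - exact: cvg_cst.
  - have /cvg_at_rightP := powR_cvg0 u0; apply; split => // n.
pose C := (2 * u) `^ u * 2.
apply: (@squeeze_cvgr _ _ _ _ (cst 0) (fun n => C * n.+2%:R^-1)).
- near=> n; rewrite mulr_ge0 ?powR_ge0 ?expR_ge0//=.
  apply: (le_trans (powR_expRN_le u _ u0 _)) => //.
  rewrite /C -mulrA ler_wpM2l ?powR_ge0// expRN -[leRHS]invf_div.
  rewrite lef_pV2 ?posrE ?expR_gt0//.
  by apply: le_trans (expR_ge1Dx _); rewrite lerDr.
- exact: cvg_cst.
- by rewrite -[X in _ --> X](mulr0 C); apply: cvgM => //; exact: cvg_cst.
Unshelve. all: by end_near. Qed.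

(** The truncated integrals satisfy the recurrence up to boundary terms that
    vanish in the limit. *)
Lemma ext_Euler_integralD1 {R : realType} (u : R) : 0 < u ->
  ext_Euler_integral (u + 1) = (u%:E * ext_Euler_integral u)%E.
Proof.
move=> u0; rewrite -(cvg_lim _ (cvg_ext_Euler_integral (u + 1)))//.
rewrite -[RHS]add0e; apply/cvg_lim => //; under eq_cvg => n.
  rewrite Euler_integral_by_parts//; last first.
    by rewrite (@lt_le_trans _ _ 1)// ?invf_lt1// ?ltr1n ?ler1n.
  over.
apply: cvgeD => //.
  by apply: cvg_EFin; [near=> n|exact: Euler_boundary_cvg].
by apply: cvgeZl => //; exact: cvg_ext_Euler_integral.
Unshelve. all: by end_near. Qed.

(** At u = 1 the integrand is the density of the exponential distribution. *)
Lemma ext_Euler_integral1_lty {R : realType} :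
  (ext_Euler_integral (1 : R) < +oo)%E.
Proof.
apply: (@le_lt_trans _ _
  (\int[lebesgue_measure]_x (exponential_pdf (1 : R) x)%:E)%E);
  last by rewrite integral_exponential_pdf ?ltry.
have -> : ext_Euler_integral (1 : R) =
    (\int[lebesgue_measure]_(s in `]0%R, +oo[)
       (exponential_pdf (1 : R) s)%:E)%E.
  apply: eq_integral => s; rewrite inE/= in_itv/= andbT => s0.
  by rewrite exponential_pdfE ?ltW// /Euler_kernel subrr powRr0 mulN1r.
apply: ge0_subset_integral => //.
- by apply/measurable_EFinP; exact: measurable_exponential_pdf.
- by move=> s _; rewrite lee_fin exponential_pdf_ge0.
Qed.

(** On [1, 2] the power s^(u - 1) is at most 1 if s <= 1 and at most s if
    s >= 1, thus at most 1 + s throughout. *)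
Lemma ext_Euler_integral_le {R : realType} (u : R) : 1 <= u <= 2 ->
  (ext_Euler_integral u <= ext_Euler_integral 1 + ext_Euler_integral 2)%E.
Proof.
move=> /andP[u1 u2].
have K0 (v : R) s : (0 <= (Euler_kernel v s)%:E)%E.
  by rewrite lee_fin Euler_kernel_ge0.
rewrite /ext_Euler_integral -ge0_integralD//;
  [|by apply/measurable_EFinP; exact: measurable_Euler_kernel..].
apply: ge0_le_integral => //.
- by apply/measurable_EFinP; exact: measurable_Euler_kernel.
- by apply: emeasurable_funD; apply/measurable_EFinP;
    exact: measurable_Euler_kernel.
move=> s; rewrite /= in_itv/= andbT => s0.
rewrite -EFinD lee_fin -mulrDl ler_wpM2r ?expR_ge0//.
have [s1|/ltW s1] := leP s 1.
  by apply: ler_wpDr (powR_ge0 _ _) _; apply: ger_powR; rewrite ?s0//; lra.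
by apply: ler_wpDl (powR_ge0 _ _) _; apply: ler_powR => //; lra.
Qed.

(** The recurrence spreads finiteness from the segment [1, 2] in both
    directions: upwards to all u >= 1, and downwards to ]0, 1[, so that the
    singularity of the integrand at 0 never has to be estimated. *)
Lemma ext_Euler_integral_lty {R : realType} (u : R) : 0 < u ->
  (ext_Euler_integral u < +oo)%E.
Proof.
have [n un] : exists n : nat, u <= n.+2%:R.
  exists (Num.truncn u); apply: le_trans (ltW (truncnS_gt u)) _.
  by rewrite ler_nat.
elim: n u un => [|n IH] u un u0; last first.
  have [u1|u1] := leP u 1; first by apply: IH; rewrite ?(le_trans u1)// ler1n.
  rewrite -(subrK 1 u) ext_Euler_integralD1 ?subr_gt0//.
  apply: lte_mul_pinfty; rewrite ?lee_fin ?subr_ge0 ?ltW//.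
  by apply: IH; rewrite ?subr_gt0// lerBlDr natr1.
have main (v : R) : 1 <= v <= 2 -> (ext_Euler_integral v < +oo)%E.
  move=> v12; apply: le_lt_trans (ext_Euler_integral_le v v12) _.
  have -> : 2 = 1 + 1 :> R by lra.
  by rewrite ext_Euler_integralD1// mul1e lte_add_pinfty//
    ext_Euler_integral1_lty.
have [u1|u1] := leP 1 u; first by apply: main; rewrite u1.
have : (ext_Euler_integral (u + 1) < +oo)%E by apply: main; lra.
rewrite ext_Euler_integralD1//.
case: (ext_Euler_integral u) => [r _| |]; rewrite ?ltry//.
by rewrite mulry gtr0_sg// mul1e.
Qed.

(** On [1, 2] the integrand is at least (1/2) exp (- 2). *)
Lemma ext_Euler_integral_gt0 {R : realType} (u : R) : 0 < u ->
  (0 < ext_Euler_integral u)%E.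
Proof.
move=> u0.
apply: (@lt_le_trans _ _
  (\int[lebesgue_measure]_(s in `[1%R, 2%R]) (2^-1 * expR (- 2) : R)%:E)%E).
  rewrite integral_cst//= lebesgue_measure_itv/= lte_fin ltr1n.
  rewrite -EFinB -EFinM lte_fin.
  by rewrite mulr_gt0 ?mulr_gt0 ?expR_gt0// subr_gt0 ltr1n.
apply: (@le_trans _ _
  (\int[lebesgue_measure]_(s in `[1%R, 2%R]) (Euler_kernel u s)%:E)%E).
  apply: ge0_le_integral => //.
  - apply/measurable_EFinP.
    apply: measurable_funS (measurable_Euler_kernel u) => // s/=.
    by rewrite !in_itv/= andbT => /andP[+ _]; apply: lt_le_trans.
  move=> s; rewrite /= in_itv/= => /andP[s1 s2].
  rewrite lee_fin ler_pM ?expR_ge0//; last by rewrite ler_expR lerN2.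
  apply: le_trans (_ : s `^ (- 1) <= _); last by apply: ler_powR => //; lra.
  by rewrite powR_inv1 ?lef_pV2 ?posrE; lra.
apply: ge0_subset_integral => //.
- by apply/measurable_EFinP; exact: measurable_Euler_kernel.
- by move=> s _; rewrite lee_fin Euler_kernel_ge0.
- by move=> s /=; rewrite !in_itv/= andbT => /andP[+ _]; apply: lt_le_trans.
Qed.

Lemma EFin_Gamma {R : realType} (u : R) : 0 < u ->
  (Gamma u)%:E = ext_Euler_integral u.
Proof.
move=> u0; rewrite /Gamma u0 fineK// ge0_fin_numE ?ext_Euler_integral_lty//.
exact/ltW/ext_Euler_integral_gt0.
Qed.

Lemma Gamma_gt0 {R : realType} (u : R) : 0 < u -> 0 < Gamma u.
Proof. by move=> u0; rewrite -lte_fin EFin_Gamma// ext_Euler_integral_gt0. Qed.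

Lemma GammaD1 {R : realType} (u : R) : 0 < u -> Gamma (u + 1) = u * Gamma u.
Proof.
move=> u0; apply: EFin_inj.
by rewrite EFinM !EFin_Gamma ?addr_gt0// ext_Euler_integralD1.
Qed.

(** * The fractional sum as a convolution *)

(** The normalised kernel of the fractional sum; up to the constant Gamma mu
    these are the coefficients of the power series of (1 - X)^(- mu). *)
Definition weight {R : realType} (mu : R) (m : nat) : R :=
  Gamma (mu + m%:R) / Gamma (m%:R + 1).

Lemma weight_gt0 {R : realType} (mu : R) m : 0 < mu -> 0 < weight mu m.
Proof.
move=> mu0; apply: divr_gt0; apply: Gamma_gt0.
  by rewrite ltr_wpDr.
by rewrite ltr_wpDl.
Qed.

Lemma weight_le {R : realType} (mu : R) m :
  0 < mu -> mu <= 1 -> weight mu m.+1 <= weight mu m.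
Proof.
move=> mu0 mu1; have m0 : 0 <= m%:R :> R by [].
have -> : weight mu m.+1 = (mu + m%:R) / (m%:R + 1) * weight mu m.
  rewrite /weight -natr1 addrA (GammaD1 (mu + m%:R)); last by lra.
  rewrite (GammaD1 (m%:R + 1)); last by lra.
  have G0 : Gamma (m%:R + 1 : R) != 0 by rewrite gt_eqF// Gamma_gt0//; lra.
  have m1 : m%:R + 1 != 0 :> R by rewrite gt_eqF//; lra.
  by field; apply/andP.
apply: ler_piMl; first exact/ltW/weight_gt0.
by rewrite ler_pdivrMr; lra.
Qed.

Lemma sum_grid {R : realType} (a0 : R) k (F : R -> R) :
  \sum_(s \in hgrid 1 a0 `&` [set s | s <= a0 + k%:R]) F s =
  \sum_(j < k.+1) F (a0 + j%:R).
Proof.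
rewrite (fsbig_ord _ _ (fun j => F (a0 + j%:R))).
rewrite -(fsbig_image _ (fun j : nat => a0 + j%:R)); last first.
  by move=> i j _ _ /addrI/eqP; rewrite eqr_nat => /eqP.
apply: eq_fsbigl; apply/seteqP; split=> s.
  case=> -[j ->] /=; rewrite mulr1 lerD2l ler_nat => jk.
  by exists j.
case=> j /= jk <-; split; first by exists j; rewrite mulr1.
by rewrite /= lerD2l ler_nat.
Qed.

(** The clause of the factorial for poles of Gamma is not met: the arguments of
    Gamma are mu + m and m + 1, both positive. *)
Lemma hfactorial_grid {R : realType} (h mu : R) m : 0 < h -> 0 < mu ->
  hfactorial h ((mu + m%:R - 1) * h) (mu - 1) = h `^ (mu - 1) * weight mu m.
Proof.
move=> h0 mu0; rewrite /hfactorial mulfK ?gt_eqF// subrK.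
have -> : mu + m%:R - (mu - 1) = m%:R + 1 by ring.
by rewrite /nonpos_int [_ <= 0]leNgt ltr_wpDl//= andbF.
Qed.

Lemma hsum_grid {R : realType} (h a mu : R) (y : R -> R) k : 0 < h -> 0 < mu ->
  hsum h a mu y (a + mu * h + k%:R * h) =
  h / Gamma mu * h `^ (mu - 1) *
    \sum_(j < k.+1) weight mu (k - j) * y (a + j%:R * h).
Proof.
move=> h0 mu0; have hN0 : h != 0 by rewrite gt_eqF.
rewrite /hsum gt_eqF// -[RHS]mulrA; congr (_ * _).
have -> : (a + mu * h + k%:R * h) / h - mu = a / h + k%:R by field.
rewrite sum_grid big_distrr/=; apply: eq_bigr => j _.
have -> : (a / h + j%:R) * h = a + j%:R * h by field.
rewrite [RHS]mulrA -hfactorial_grid//; congr (hfactorial _ _ _ * _).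
by rewrite /hsigma natrB ?ltnS -1?ltnS//; ring.
Qed.

(** * Monotone convolutions *)

(** Since the differences w_m - w_(m+1) are nonnegative and telescope,
    the monotonicity of the convolution bounds w_0 z_(k+1) below by a
    combination of the earlier terms with total weight w_0 - w_(k+1) <= w_0. *)
Lemma convolution_le {R : realDomainType} (w z : nat -> R) :
    (forall m, 0 < w m) -> (forall m, w m.+1 <= w m) -> z 0 <= 0 ->
    (forall k, \sum_(j < k.+1) w (k - j)%N * z j <=
               \sum_(j < k.+2) w (k.+1 - j)%N * z j) ->
  forall k, z 0 <= z k.
Proof.
move=> w_gt0 w_le z0 wz_le; elim/ltn_ind => -[//|k] IH.
have := wz_le k; rewrite [leRHS]big_ord_recr/= subnn -lerBlDl -sumrB => le1.
rewrite -(ler_pM2l (w_gt0 0)); apply: le_trans le1.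
have -> : \sum_(j < k.+1) (w (k - j)%N * z j - w (k.+1 - j)%N * z j) =
          \sum_(j < k.+1) (w (k - j)%N - w (k - j).+1) * z j.
  by apply: eq_bigr => j _; rewrite subSn -1?ltnS// mulrBl.
apply: (@le_trans _ _ (\sum_(j < k.+1) (w (k - j)%N - w (k - j).+1) * z 0));
  last by apply: ler_sum => j _; rewrite ler_wpM2l ?subr_ge0 ?IH.
(* Reversing the order of summation makes the differences telescope. *)
rewrite -mulr_suml.
rewrite -(big_mkord xpredT (fun j => w (k - j)%N - w (k - j).+1)).
rewrite big_nat_rev/= add0n.
rewrite (@eq_big_nat _ _ _ _ _ _ (fun i => - (w i.+1 - w i))); last first.
  by move=> i /andP[_ ik]; rewrite subSS subKn// opprB.
rewrite sumrN telescope_sumr//.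
by have := w_gt0 k.+1; nra.
Qed.

(** * The comparison *)

Theorem lemma3p14 (R : realType) (h a nu : R) (x y : R -> R)
    (h_gt0 : 0 < h) (nu_gt0 : 0 < nu) (nu_le1 : nu <= 1)
    (le_diff : forall t : R, hgrid h (a + (1 - nu) * h) t ->
                 RL_hdiff h a nu x t >= RL_hdiff h a nu y t)
    (le_a : x a <= y a) :
  forall t : R, hgrid h a t -> x t - y t >= x a - y a.
Proof.
pose z j := x (a + j%:R * h) - y (a + j%:R * h).
suff z_ge : forall k, z 0 <= z k.
  by move=> t [k ->]; have := z_ge k; rewrite /z mul0r addr0.
have le_hsum (k : nat) : let S u := hsum h a (1 - nu) u in
    let t := a + (1 - nu) * h + k%:R * h in
    S y (t + h) - S y t <= S x (t + h) - S x t.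
  have /le_diff := ex_intro _ k erefl : hgrid h (a + (1 - nu) * h) _.
  by rewrite /RL_hdiff /hdiff ler_pM2r ?invr_gt0.
have [nu1|nu_neq1] := eqVneq nu 1.
  elim=> // k IH; apply: le_trans IH _.
  have := le_hsum k; rewrite /= /hsum nu1 subrr eqxx mul0r addr0.
  have -> : a + k%:R * h + h = a + k.+1%:R * h by rewrite -natr1; ring.
  by rewrite /z; lra.
have mu_gt0 : 0 < 1 - nu by rewrite subr_gt0 lt_neqAle nu_neq1.
set mu := 1 - nu in le_hsum mu_gt0.
apply: (@convolution_le _ (weight mu)) => [m|m||k].
- exact: weight_gt0.
- by apply: weight_le => //; rewrite /mu; lra.
- by rewrite /z mul0r addr0 subr_le0.
- move: (le_hsum k) => /=.
  have -> : a + mu * h + k%:R * h + h = a + mu * h + k.+1%:R * h.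
    by rewrite -natr1; ring.
  rewrite !hsum_grid// -!mulrBr ler_pM2l; last first.
    by rewrite mulr_gt0 ?powR_gt0// divr_gt0// Gamma_gt0.
  rewrite /z.
  under [X in _ -> X <= _]eq_bigr do rewrite mulrBr.
  under [X in _ -> _ <= X]eq_bigr do rewrite mulrBr.
  by rewrite !sumrB; lra.
Qed.
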